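(* Let $A$ be a non-degenerate ring that is a subring of a unital ring $T$. Then the following assertions are equivalent: (i) $A$ is dense in $T$ with respect to the strict topology; (ii) $A$ is a two-sided ideal of $T$ and has local units. Likewise, in the one-sided version, the following are equivalent: (i') $A$ is dense in $T$ with respect to the left strict topology; (ii') $A$ is a left ideal of $T$ and has left local units.
   Context: Rings are associative; $A$ is not assumed to have an identity. $A$ is non-degenerate if for every $a\in A$: ($ab=0$ for all $b\in A$) implies $a=0$, and ($ba=0$ for all $b\in A$) implies $a=0$. $A$ has left local units if for any finite subset $a_1,\dots,a_n$ of $A$ there is $e\in A$ with $ea_i=a_i$ for all $i$; it has local units if for any such finite subset there is $e\in A$ with $ea_i=a_i$ and $a_ie=a_i$ for all $i$. The left strict topology on $T$ (with respect to $A$): a net $(x_\alpha)$ in $T$ converges to $x\in T$ if for every $a\in A$ one has $x_\alpha a=xa$ for $\alpha$ large enough. A basis of open sets is given by the sets $\{y\in T\mid ya_i=xa_i,\ i=1,\dots,n\}$ with $x\in T$ and $a_1,\dots,a_n\in A$. The (two-sided) strict topology on $T$: a net $(x_\alpha)$ converges to $x$ if for every $a\in A$ one has $x_\alpha a=xa$ and $ax_\alpha=ax$ for $\alpha$ large enough. A basis of open sets is given by the sets $\{y\in T\mid a_iy=a_ix \text{ and } ya_i=xa_i,\ i=1,\dots,n\}$ with $x\in T$ and $a_1,\dots,a_n\in A$. These topologies are also called the ($A$-adic) topologies on $T$. *)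

(* Defs.v *)
From HB Require Import structures.
From mathcomp Require Import all_boot all_order all_algebra.
From mathcomp Require Import all_classical.
From mathcomp Require Import filter topology.

Set Implicit Arguments.
Unset Strict Implicit.
Unset Printing Implicit Defensive.

Import GRing.Theory.
Local Open Scope classical_set_scope.
Local Open Scope ring_scope.

(* Unital rings are [pzRingType]s: the zero ring is allowed. A subring A of T *)
(* need not contain an identity, so it is a subset of T closed under the ring *)
(* operations, and statements about the ring A quantify over x in T with A x. *)

Section Rings.
Variable T : pzRingType.
Implicit Type A : set T.

(* 1 is not required to belong to A, unlike in [GRing.subring_closed] *)
Definition is_subring A : Prop :=
  GRing.zmod_closed (mem A) /\ GRing.mulr_2closed (mem A).

Definition is_nondegenerate A : Prop :=
  forall a, A a ->
    ((forall b, A b -> a * b = 0) -> a = 0) /\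
    ((forall b, A b -> b * a = 0) -> a = 0).

(* [idealr_closed] of ring_quotient is not suitable: it excludes A = T *)
Definition is_left_ideal A : Prop :=
  GRing.zmod_closed (mem A) /\ forall t a, A a -> A (t * a).

Definition is_two_sided_ideal A : Prop :=
  is_left_ideal A /\ forall t a, A a -> A (a * t).

Definition has_left_local_units A : Prop :=
  forall s : seq T, [set` s] `<=` A ->
    exists2 e, A e & forall a, a \in s -> e * a = a.

Definition has_local_units A : Prop :=
  forall s : seq T, [set` s] `<=` A ->
    exists2 e, A e & forall a, a \in s -> e * a = a /\ a * e = a.

Definition left_strict_basic (x : T) (s : seq T) : set T :=
  [set y | forall a, a \in s -> y * a = x * a].

Definition strict_basic (x : T) (s : seq T) : set T :=
  [set y | forall a, a \in s -> a * y = a * x /\ y * a = x * a].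

Definition left_strict_base A : set (set T) :=
  [set U | exists x s, [set` s] `<=` A /\ U = left_strict_basic x s].

Definition strict_base A : set (set T) :=
  [set U | exists x s, [set` s] `<=` A /\ U = strict_basic x s].

Lemma left_strict_base_cover A : \bigcup_(U in left_strict_base A) U = setT.
Proof.
rewrite -subTset => x _; exists (left_strict_basic x [::]) => //.
by exists x, [::]; split.
Qed.

Lemma strict_base_cover A : \bigcup_(U in strict_base A) U = setT.
Proof.
rewrite -subTset => x _; exists (strict_basic x [::]) => //.
by exists x, [::]; split.
Qed.

Lemma left_strict_base_join A (U V : set T) (z : T) :
  left_strict_base A U -> left_strict_base A V -> U z -> V z ->
  exists W, [/\ left_strict_base A W, W z & W `<=` U `&` V].
Proof.
move=> [x [s [sA ->]]] [y [t [tA ->]]] xz yz.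
exists (left_strict_basic z (s ++ t)); split=> //.
  exists z, (s ++ t); split=> // a /=; rewrite mem_cat.
  by case/orP; [apply: sA | apply: tA].
move=> w wz; split=> a aI; rewrite wz ?mem_cat ?aI ?orbT //.
- exact: xz.
- exact: yz.
Qed.

Lemma strict_base_join A (U V : set T) (z : T) :
  strict_base A U -> strict_base A V -> U z -> V z ->
  exists W, [/\ strict_base A W, W z & W `<=` U `&` V].
Proof.
move=> [x [s [sA ->]]] [y [t [tA ->]]] xz yz.
exists (strict_basic z (s ++ t)); split=> //.
  exists z, (s ++ t); split=> // a /=; rewrite mem_cat.
  by case/orP; [apply: sA | apply: tA].
move=> w wz; split=> a aI; have [|-> ->] := wz a; rewrite ?mem_cat ?aI ?orbT //.
- exact: xz.
- exact: yz.
Qed.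

End Rings.

(* T carries one topology for each A, so each topology lives on an alias. *)
Definition left_strict_space (T : pzRingType) (A : set T) : Type := T.
Definition strict_space (T : pzRingType) (A : set T) : Type := T.

HB.instance Definition _ (T : pzRingType) (A : set T) :=
  Choice.copy (left_strict_space A) T.
HB.instance Definition _ (T : pzRingType) (A : set T) :=
  isBaseTopological.Build (left_strict_space A) (b := id)
    (left_strict_base_cover A) (@left_strict_base_join T A).

HB.instance Definition _ (T : pzRingType) (A : set T) :=
  Choice.copy (strict_space A) T.
HB.instance Definition _ (T : pzRingType) (A : set T) :=
  isBaseTopological.Build (strict_space A) (b := id)
    (strict_base_cover A) (@strict_base_join T A).

(* The description of the topologies by nets, in terms of filters. *)
Lemma left_strict_cvgP (T : pzRingType) (A : set T)
    (F : set_system (left_strict_space A)) (x : left_strict_space A) : Filter F ->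
  F --> x <->
  forall a, A a -> \forall y \near F, (y : T) * a = (x : T) * a.
Proof.
move=> FF; split=> [Fx a Aa|Fx P].
  apply: Fx; exists (left_strict_basic (x : T) [:: a]); split.
  - exists [set left_strict_basic (x : T) [:: a]]; last by rewrite bigcup_set1.
    move=> _ ->; exists (x : T), [:: a]; split=> //.
    by move=> b /=; rewrite inE => /eqP ->.
  - by [].
  - by move=> y /= ya; apply: ya; rewrite inE.
move=> [B [[D DA <-] [U DU Ux] BP]].
have [z [s [sA Us]]] := DA _ DU; rewrite {}Us in DU Ux *.
apply: (@filterS _ F FF (left_strict_basic z s)).
  by move=> y ys; apply: BP; exists (left_strict_basic z s).
elim: s sA Ux {DU} => [|a s IH] sA Ux; first by apply: filterS filterT => y _ b.
have Hs : F (left_strict_basic z s).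
  apply: IH => [b bs|b bs]; first by apply: sA; rewrite /= inE bs orbT.
  by apply: Ux; rewrite inE bs orbT.
have Ha : A a by apply: sA; rewrite /= inE eqxx.
apply: filterS2 (Fx a Ha) Hs => y ya ys b; rewrite inE => /orP[/eqP->|/ys //].
by rewrite ya Ux // inE eqxx.
Qed.

Lemma strict_cvgP (T : pzRingType) (A : set T)
    (F : set_system (strict_space A)) (x : strict_space A) : Filter F ->
  F --> x <->
  forall a, A a ->
    \forall y \near F, (y : T) * a = (x : T) * a /\ a * (y : T) = a * (x : T).
Proof.
move=> FF; split=> [Fx a Aa|Fx P].
  apply: Fx; exists (strict_basic (x : T) [:: a]); split.
  - exists [set strict_basic (x : T) [:: a]]; last by rewrite bigcup_set1.
    move=> _ ->; exists (x : T), [:: a]; split=> //.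
    by move=> b /=; rewrite inE => /eqP ->.
  - by [].
  - by move=> y /= ya; have [|-> ->] := ya a; rewrite ?inE.
move=> [B [[D DA <-] [U DU Ux] BP]].
have [z [s [sA Us]]] := DA _ DU; rewrite {}Us in DU Ux *.
apply: (@filterS _ F FF (strict_basic z s)).
  by move=> y ys; apply: BP; exists (strict_basic z s).
elim: s sA Ux {DU} => [|a s IH] sA Ux; first by apply: filterS filterT => y _ b.
have Hs : F (strict_basic z s).
  apply: IH => [b bs|b bs]; first by apply: sA; rewrite /= inE bs orbT.
  by apply: Ux; rewrite inE bs orbT.
have Ha : A a by apply: sA; rewrite /= inE eqxx.
apply: filterS2 (Fx a Ha) Hs => y [ya ay] ys b; rewrite inE => /orP[/eqP->|/ys //].
by rewrite ya ay; apply: Ux; rewrite inE eqxx.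
Qed.

(* Main.v *)
Require Import Defs.
From mathcomp Require Import all_boot all_order all_algebra.
From mathcomp Require Import all_classical.
From mathcomp Require Import filter topology.

(* Density says that every x in T agrees with some y in A under multiplication
   on any given finite subset of A. Taking x = 1 produces local units; a
   singleton subset {a} gives x a = y a in A, so A is an ideal. Conversely, if e
   is a local unit for the finite subset, then x e (one-sided case), or
   e x + x e - e x e (two-sided case), lies in A and agrees with x on it. *)

Set Implicit Arguments.
Unset Strict Implicit.
Unset Printing Implicit Defensive.

Import GRing.Theory.
Local Open Scope classical_set_scope.
Local Open Scope ring_scope.

(** Each member of the base is itself open, and each point of an open set lies in a member of the
    base contained in that set. Density tests only nonempty open sets, hence the condition that
    members of [B] be nonempty. *)
Lemma dense_baseP (X : topologicalType) (B : set_system X) (A : set X) :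
  open = [set \bigcup_(U in D) U | D in subset^~ B] -> (forall U, B U -> U !=set0) ->
  dense A <-> forall U, B U -> U `&` A !=set0.
Proof.
move=> openB B0; split=> [dA U BU | BA O [x Ox]].
  apply: dA; first exact: B0.
  rewrite openB; exists [set U]; last by rewrite bigcup_set1.
  by move=> _ ->.
rewrite openB => -[D DB DO]; move: Ox; rewrite -DO => -[U DU _].
by have [y [Uy Ay]] := BA _ (DB _ DU); exists y; split=> //; exists U.
Qed.

Lemma dense_left_strictP (T : pzRingType) (A : set T) :
  dense (A : set (left_strict_space A)) <->
  forall (x : T) (s : seq T), [set` s] `<=` A ->
    exists2 y, A y & forall a, a \in s -> y * a = x * a.
Proof.
(* Open sets here are by definition unions of basic sets, so the first premise holds by conversion;
   for the second, a basic set contains its centre [x]. *)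
rewrite (@dense_baseP (left_strict_space A) (left_strict_base A)) //; last first.
  by move=> _ [x [s [_ ->]]]; exists x.
split=> [dA x s sA | dA _ [x [s [sA ->]]]].
  by have [|y [ys Ay]] := dA (left_strict_basic x s);
    [exists x, s | exists y].
by have [y Ay ys] := dA x s sA; exists y.
Qed.

Lemma dense_strictP (T : pzRingType) (A : set T) :
  dense (A : set (strict_space A)) <->
  forall (x : T) (s : seq T), [set` s] `<=` A ->
    exists2 y, A y & forall a, a \in s -> a * y = a * x /\ y * a = x * a.
Proof.
rewrite (@dense_baseP (strict_space A) (strict_base A)) //; last first.
  by move=> _ [x [s [_ ->]]]; exists x.
split=> [dA x s sA | dA _ [x [s [sA ->]]]].
  by have [|y [ys Ay]] := dA (strict_basic x s); [exists x, s | exists y].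
by have [y Ay ys] := dA x s sA; exists y.
Qed.

Lemma subring_mul (T : pzRingType) (A : set T) (x y : T) :
  is_subring A -> A x -> A y -> A (x * y).
Proof. by move=> [_ AM] Ax Ay; apply/set_mem/AM; apply/mem_set. Qed.

Lemma sub_seq1 (T : choiceType) (A : set T) (a : T) :
  A a -> [set` [:: a]] `<=` A.
Proof. by move=> Aa b /=; rewrite inE => /eqP->. Qed.

Lemma dense_left_strict_iff (T : pzRingType) (A : set T) :
  is_subring A ->
  dense (A : set (left_strict_space A)) <->
    is_left_ideal A /\ has_left_local_units A.
Proof.
move=> subA; rewrite dense_left_strictP; split=> [dA|[[_ AM] unitA] x s sA].
  split; first split; first exact: subA.1.
    move=> t a Aa; have [y Ay ya] := dA t _ (sub_seq1 Aa).
    by rewrite -ya ?mem_head //; exact: subring_mul.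
  move=> s sA; have [e Ae es] := dA 1 s sA.
  by exists e => // a /es; rewrite mul1r.
have [e Ae es] := unitA s sA.
(* Associativity lets [e] act on [a] first, where it is absorbed. *)
by exists (x * e); [exact: AM | move=> a /es ea; rewrite -mulrA ea].
Qed.

Lemma dense_strict_iff (T : pzRingType) (A : set T) :
  is_subring A ->
  dense (A : set (strict_space A)) <->
    is_two_sided_ideal A /\ has_local_units A.
Proof.
move=> subA; rewrite dense_strictP; split=> [dA|[[[A0 AMl] AMr] unitA] x s sA].
  (* Each of the two equations replaces [t] by an element of [A] in a product with [a], giving one
     side of the ideal property. *)
  have agree t a : A a -> exists2 y, A y & a * y = a * t /\ y * a = t * a.
    move=> Aa; have [y Ay ya] := dA t _ (sub_seq1 Aa).
    by exists y => //; apply: ya; exact: mem_head.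
  split; first split; first split; first exact: subA.1.
  - by move=> t a Aa; have [y Ay [_ <-]] := agree t a Aa; exact: subring_mul.
  - by move=> t a Aa; have [y Ay [<- _]] := agree t a Aa; exact: subring_mul.
  - move=> s sA; have [e Ae es] := dA 1 s sA.
    by exists e => // a /es[-> ->]; rewrite mul1r mulr1.
have [e Ae es] := unitA s sA.
have AB u v : A u -> A v -> A (u - v).
  by move=> Au Av; apply/set_mem/A0.2; apply/mem_set.
(* Subtracting this witness from [x] leaves [(1 - e) * x * (1 - e)], which every [a] in [s]
   annihilates on both sides, since [a * (1 - e) = 0] and [(1 - e) * a = 0]. The nested differences
   make closure under subtraction suffice for membership. *)
exists (x * e - (e * x * e - e * x)).
  exact: AB (AMl _ _ Ae) (AB _ _ (AMl _ _ Ae) (AMr _ _ Ae)).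
move=> a /es[ea ae]; split.
  by rewrite !mulrBr !mulrA ae opprB addrC subrK.
by rewrite !mulrBl -!mulrA ea subrr subr0.
Qed.

Theorem proposition2p9 (T : pzRingType) (A : set T)
    (subringA : is_subring A) (nondegA : is_nondegenerate A) :
  (dense (A : set (strict_space A)) <->
     is_two_sided_ideal A /\ has_local_units A) /\
  (dense (A : set (left_strict_space A)) <->
     is_left_ideal A /\ has_left_local_units A).
Proof. by split; [exact: dense_strict_iff | exact: dense_left_strict_iff]. Qed.
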